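(* There exists a constant $C>0$ independent of $d$ and $\mathcal T$ such that the following holds. Let $\Omega\subset\mathbb R^d$, $d\ge2$, be a bounded polytopal domain with a regular, simplicial partition $\mathcal T$. For $p\in\mathcal V$ let $T_1,\dots,T_{s(p)}\in\mathcal T$ be the simplices adjacent to $p$, let $\tilde\theta_{p,j}^{\mathrm S^1_1}$, $j=1,\dots,s(p)$, be the hat functions on the sets $\tilde\omega_j(p)$ (constructed with sufficiently small $\delta_j>0$), and let $\tilde\Phi^{CPwL}_{p,j}$, $j=1,\dots,s(p)$, be the ReLU NNs satisfying $R(\tilde\Phi^{CPwL}_{p,j})=\tilde\theta^{\mathrm S^1_1}_{p,j}$ on $\Omega$ (all given in the context). Then $$\Phi_p^{CPwL}:=\Phi^{\max}_{s(p)}\odot P\big(\tilde\Phi^{CPwL}_{p,1},\dots,\tilde\Phi^{CPwL}_{p,s(p)}\big)$$ satisfies $R(\Phi_p^{CPwL})(x)=\theta_p^{\mathrm S^1_1}(x)$ for all $x\in\Omega$ and $$L(\Phi_p^{CPwL})\le 7+\log_2(s(p))+\log_2(d+1),\qquad M(\Phi_p^{CPwL})\le C\,d^2\,s(p).$$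
   Context: **Neural networks (NNs).** A NN with input dimension $d$ and depth $L$ is a finite sequence $\Phi=((A_1,b_1,\varrho_1),\dots,(A_L,b_L,\varrho_L))$ where, with $N_0=d$ and $N_1,\dots,N_L\in\mathbb N$, $A_\ell\in\mathbb R^{N_\ell\times N_{\ell-1}}$, $b_\ell\in\mathbb R^{N_\ell}$, and $\varrho_\ell$ is a list of $N_\ell$ activation functions acting componentwise; $\varrho_L=\mathrm{Id}$. Its realization is $R(\Phi):\mathbb R^d\to\mathbb R^{N_L}$, $x\mapsto x_L$, with $x_0=x$, $x_\ell=\varrho_\ell(A_\ell x_{\ell-1}+b_\ell)$ for $1\le\ell<L$, $x_L=A_Lx_{L-1}+b_L$. Depth: $L(\Phi)=L$. Size: $M(\Phi)=\sum_\ell(\|A_\ell\|_0+\|b_\ell\|_0)$, where $\|\cdot\|_0$ counts nonzero entries. ReLU: $\rho(x)=\max\{0,x\}$; a ReLU NN has only activations $\rho$ in hidden layers (depth-one networks included). **Operations.** For NNs of equal depth and input dimension, the parallelization $P(\Phi^1,\Phi^2)$ has $A_1=\binom{A_1^{(1)}}{A_1^{(2)}}$, $A_\ell=\mathrm{diag}(A^{(1)}_\ell,A^{(2)}_\ell)$ for $\ell\ge2$ and stacked biases and activations, so $R(P(\Phi^1,\Phi^2))=(R(\Phi^1),R(\Phi^2))$; it is iterated for more networks. The sparse concatenation $\Phi^1\odot\Phi^2$ (output dimension of $\Phi^2$ = input dimension of $\Phi^1$) has depth $L(\Phi^1)+L(\Phi^2)$: hidden layers of $\Phi^2$, then a ReLU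 layer with weights $\binom{A}{-A}$, $\binom{b}{-b}$ where $(A,b)$ is the last layer of $\Phi^2$, then the layers of $\Phi^1$ with first weight matrix $A_1^{(1)}$ replaced by $(A_1^{(1)}\ {-A_1^{(1)}})$; $R(\Phi^1\odot\Phi^2)=R(\Phi^1)\circ R(\Phi^2)$. **Max/min networks.** For every $n\in\mathbb N$, $\Phi^{\max}_n$ and $\Phi^{\min}_n$ denote fixed ReLU NNs realizing $x\mapsto\max\{x_1,\dots,x_n\}$ and $x\mapsto\min\{x_1,\dots,x_n\}$ on $\mathbb R^n$, with depth $\le2+\log_2(n)$ and size $\le C_0n$, $C_0$ an absolute constant. **Meshes.** $\mathrm{conv}(Y)=\{\sum_{y\in Y}\lambda_yy:\lambda_y>0,\sum\lambda_y=1\}$ is the open convex hull; a $d$-simplex is $\mathrm{conv}(\{a_0,\dots,a_d\})$ with affinely independent $a_i\in\mathbb R^d$. A regular, simplicial partition $\mathcal T$ of $\Omega$ is a finite set of pairwise disjoint $d$-simplices with $\overline\Omega=\bigcup_T\overline T$ such that for distinct $T,T'$ the set $\overline T\cap\overline{T'}$ is empty or the closure of a common subsimplex. $\mathcal V$: set of vertices; the simplices adjacent to $p\in\mathcal V$ are those $T\in\mathcal T$ with $p\in\overline T$, $s(p)$ is their number. $\theta_p^{\mathrm S^1_1}$: the continuous function, affine on each $T\in\mathcal T$, equal to $1$ at $p$ and $0$ at all other vertices. **Auxiliary hat functions.** For $p\in\mathcal V$ and $j=1,\dots,s(p)$ let $a_0:=p$ and $a_1,\dots,a_d$ be such that $T_j=\mathrm{conv}(\{a_0,\dots,a_d\})$,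 and let $q_j:=p+\delta_j\sum_{i=1}^d(p-a_i)$ for a sufficiently small $\delta_j>0$ (i.e. $0<\delta_j\le\bar\delta$ for some $\bar\delta>0$ depending on $p$, $\mathcal T$). Set $\tilde T_{0j}:=T_j$, $\tilde T_{ij}:=\mathrm{conv}(\{q_j,a_0,\dots,a_d\}\setminus\{a_i\})$ for $i=1,\dots,d$, and $\tilde\omega_j(p):=\bigcup_{i=0}^d\overline{\tilde T_{ij}}$. The continuous function $\tilde\theta^{\mathrm S^1_1}_{p,j}$ on $\Omega$ is determined by: value $1$ at $p$, value $0$ at $q_j,a_1,\dots,a_d$, affine on each $\tilde T_{ij}$, $i=0,\dots,d$, and $0$ outside $\tilde\omega_j(p)$. Let $x\mapsto\tilde A_p^{(i,j)}x+\tilde b_p^{(i,j)}$ be the globally affine function that coincides with $\tilde\theta^{\mathrm S^1_1}_{p,j}$ on $\tilde T_{ij}$. Then $$\tilde\Phi^{CPwL}_{p,j}:=\big((1,0,\rho),(1,0,\mathrm{Id}_{\mathbb R})\big)\odot\Phi^{\min}_{d+1}\odot\left(\left(\begin{pmatrix}\tilde A_p^{(0,j)}\\\vdots\\\tilde A_p^{(d,j)}\end{pmatrix},\begin{pmatrix}\tilde b_p^{(0,j)}\\\vdots\\\tilde b_p^{(d,j)}\end{pmatrix},\mathrm{Id}_{\mathbb R^{d+1}}\right)\right),$$ which realizes $x\mapsto\max\{0,\min_{i=0,\dots,d}(\tilde A_p^{(i,j)}x+\tilde b_p^{(i,j)})\}$. *)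

(* Defs.v *)
From HB Require Import structures.
From mathcomp Require Import all_boot all_order all_algebra.
From mathcomp Require Import all_classical all_reals all_analysis.

Set Implicit Arguments.
Unset Strict Implicit.
Unset Printing Implicit Defensive.

Import Order.TTheory GRing.Theory Num.Theory.
Import numFieldNormedType.Exports.

Local Open Scope classical_set_scope.
Local Open Scope ring_scope.

Definition log2 (R : realType) (x : R) : R := ln x / ln 2.

Section NeuralNetworks.
Variable R : realType.

(* [nn n m L] is the type of networks with input dimension n, output dimension
   m and L hidden layers, hence of depth L.+1. The last layer carries no
   activation, since it is always the identity; a hidden layer of width k
   carries one activation function for each of its k neurons. *)
Inductive nn (n m : nat) : nat -> Type :=
| nn_out of 'M[R]_(m, n) & 'cV[R]_m : nn n m 0
| nn_hid (L k : nat) of 'M[R]_(k, n) & 'cV[R]_k & ('I_k -> R -> R) & nn k m L :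
    nn n m L.+1.

Definition relu (x : R) : R := Num.max 0 x.

Fixpoint realize n m L (phi : nn n m L) : 'cV[R]_n -> 'cV[R]_m :=
  match phi with
  | nn_out A b => fun x => A *m x + b
  | nn_hid _ _ A b rho psi =>
      fun x => realize psi (\col_i rho i ((A *m x + b) i 0))
  end.

Definition depth n m L (phi : nn n m L) : nat := L.+1.

Definition norm0 p q (A : 'M[R]_(p, q)) : nat :=
  #|[pred ij : 'I_p * 'I_q | A ij.1 ij.2 != 0]|.

Fixpoint nn_size n m L (phi : nn n m L) : nat :=
  match phi with
  | nn_out A b => norm0 A + norm0 b
  | nn_hid _ _ A b _ psi => norm0 A + norm0 b + nn_size psi
  end.

Fixpoint relu_nn n m L (phi : nn n m L) : Prop :=
  match phi with
  | nn_out _ _ => True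
  | nn_hid _ _ _ _ rho psi => (forall i, rho i = relu) /\ relu_nn psi
  end.

(* Two networks of equal depth side by side, on separate inputs: from the
   second layer on, this is what the parallelization does. *)
Fixpoint nn_diag n1 n2 m1 m2 L (phi1 : nn n1 m1 L) :
    nn n2 m2 L -> nn (n1 + n2) (m1 + m2) L :=
  match phi1 in nn _ _ L return nn n2 m2 L -> nn (n1 + n2) (m1 + m2) L with
  | nn_out A1 b1 => fun phi2 =>
      match phi2 with
      | nn_out A2 b2 => nn_out (block_mx A1 0 0 A2) (col_mx b1 b2)
      end
  | nn_hid _ k1 A1 b1 rho1 psi1 => fun phi2 =>
      match phi2 in nn _ _ L' return
        match L' with
        | 0 => unit
        | L.+1 => (forall k2, nn k2 m2 L -> nn (k1 + k2) (m1 + m2) L) ->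
                  nn (n1 + n2) (m1 + m2) L.+1
        end with
      | nn_out _ _ => tt
      | nn_hid _ k2 A2 b2 rho2 psi2 => fun diag1 =>
          nn_hid (block_mx A1 0 0 A2) (col_mx b1 b2)
            (fun i => match fintype.split i with
                      | inl i1 => rho1 i1
                      | inr i2 => rho2 i2
                      end)
            (diag1 k2 psi2)
      end (fun k2 => @nn_diag k1 k2 m1 m2 _ psi1)
  end.

(* The parallelization of two networks with a common input, and its iteration
   P(Phi_0, P(Phi_1, ...)) for a nonempty family of scalar-valued networks. *)
Definition nn_par n m1 m2 L (phi1 : nn n m1 L) :
    nn n m2 L -> nn n (m1 + m2) L :=
  match phi1 in nn _ _ L return nn n m2 L -> nn n (m1 + m2) L with
  | nn_out A1 b1 => fun phi2 =>
      match phi2 with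
      | nn_out A2 b2 => nn_out (col_mx A1 A2) (col_mx b1 b2)
      end
  | nn_hid L k1 A1 b1 rho1 psi1 => fun phi2 =>
      match phi2 in nn _ _ L' return
        match L' with
        | 0 => unit
        | L.+1 => nn k1 m1 L -> nn n (m1 + m2) L.+1
        end with
      | nn_out _ _ => tt
      | nn_hid _ k2 A2 b2 rho2 psi2 => fun psi1 =>
          nn_hid (col_mx A1 A2) (col_mx b1 b2)
            (fun i => match fintype.split i with
                      | inl i1 => rho1 i1
                      | inr i2 => rho2 i2
                      end)
            (nn_diag psi1 psi2)
      end psi1
  end.

Fixpoint nn_pars n L s : ('I_s.+1 -> nn n 1 L) -> nn n s.+1 L :=
  match s with
  | 0 => fun phi => phi ord0
  | s'.+1 => fun phi =>
      nn_par (phi ord0) (nn_pars (fun j : 'I_s'.+1 => phi (lift ord0 j)))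
  end.

(* Replaces the first weight matrix A by the block matrix (A, -A). *)
Definition nn_split_input n m L (phi : nn n m L) : nn (n + n) m L :=
  match phi with
  | nn_out A b => nn_out (row_mx A (- A)) b
  | nn_hid _ _ A b rho psi => nn_hid (row_mx A (- A)) b rho psi
  end.

(* The sparse concatenation of phi1 with phi2, where phi2 is applied first. Its
   depth is L2.+1 + L1.+1. *)
Fixpoint nn_concat n k m L1 L2 (phi1 : nn k m L1) (phi2 : nn n k L2) :
    nn n m (L2 + L1.+1) :=
  match phi2 in nn _ _ L2 return nn n m (L2 + L1.+1) with
  | nn_out A b =>
      nn_hid (col_mx A (- A)) (col_mx b (- b)) (fun _ => relu)
        (nn_split_input phi1)
  | nn_hid _ _ A b rho psi2 => nn_hid A b rho (nn_concat phi1 psi2)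
  end.

Definition nn_max_family (C0 : R) (L : nat -> nat)
    (Phi : forall n, nn n 1 (L n)) : Prop :=
  forall n, [/\ relu_nn (Phi n.+1),
    forall x : 'cV[R]_n.+1,
      realize (Phi n.+1) x 0 0 = \big[Num.max/x 0 0]_(i < n.+1) x i 0,
    (depth (Phi n.+1))%:R <= 2 + log2 (n.+1%:R : R) &
    (nn_size (Phi n.+1))%:R <= C0 * n.+1%:R].

Definition nn_min_family (C0 : R) (L : nat -> nat)
    (Phi : forall n, nn n 1 (L n)) : Prop :=
  forall n, [/\ relu_nn (Phi n.+1),
    forall x : 'cV[R]_n.+1,
      realize (Phi n.+1) x 0 0 = \big[Num.min/x 0 0]_(i < n.+1) x i 0,
    (depth (Phi n.+1))%:R <= 2 + log2 (n.+1%:R : R) &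
    (nn_size (Phi n.+1))%:R <= C0 * n.+1%:R].

(* ((1, 0, relu), (1, 0, Id)) *)
Definition nn_relu1 : nn 1 1 1 :=
  nn_hid (1%:M : 'M[R]_1) 0 (fun _ => relu) (nn_out 1%:M 0).

(* The i-th row of A and the i-th entry of b hold the affine function of the
   i-th subsimplex. *)
Definition nn_aux_hat d (L : nat -> nat) (Phimin : forall n, nn n 1 (L n))
    (A : 'M[R]_(d.+1, d)) (b : 'cV[R]_d.+1) : nn d 1 _ :=
  nn_concat nn_relu1 (nn_concat (Phimin d.+1) (nn_out A b)).

End NeuralNetworks.

Section Meshes.
Variables (R : realType) (d : nat).
Local Notation V := 'cV[R]_d.

(* The open convex hull: all weights are positive. *)
Definition conv (I : finType) (a : I -> V) : set V :=
  [set x | exists lam : I -> R,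
     [/\ forall i, 0 < lam i, \sum_i lam i = 1 & x = \sum_i lam i *: a i]].

Definition aff_indep k (a : 'I_k.+1 -> V) : Prop :=
  free [tuple a (lift ord0 i) - a ord0 | i < k].

Definition is_simplex (a : 'I_d.+1 -> V) (T : set V) : Prop :=
  aff_indep a /\ T = conv a.

Definition vertex_of (T : set V) (v : V) : Prop :=
  exists a i, is_simplex a T /\ v = a i.

Definition subsimplex (S T : set V) : Prop :=
  exists k (c : 'I_k.+1 -> V),
    [/\ injective c, forall i, vertex_of T (c i) & S = conv c].

Definition polytope (Q : set V) : Prop :=
  exists k (c : 'I_k.+1 -> V), Q = closure (conv c).

Definition bounded_polytopal_domain (Omega : set V) : Prop :=
  [/\ open Omega, connected Omega, Omega !=set0, bounded_set Omega &
      exists F : set (set V),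
        [/\ finite_set F, forall Q, F Q -> polytope Q &
            closure Omega = \bigcup_(Q in F) Q]].

Definition regular_simplicial_partition (Omega : set V) (TT : set (set V)) :
    Prop :=
  [/\ finite_set TT,
      forall T, TT T -> exists a, is_simplex a T,
      trivIset TT id,
      closure Omega = \bigcup_(T in TT) closure T &
      forall T T', TT T -> TT T' -> T <> T' ->
        closure T `&` closure T' = set0 \/
        exists S, [/\ subsimplex S T, subsimplex S T' &
                      closure T `&` closure T' = closure S]].

Definition mesh_vertex (TT : set (set V)) (v : V) : Prop :=
  exists2 T, TT T & vertex_of T v.

Definition adjacent_simplices (TT : set (set V)) (p : V) : set (set V) :=
  [set T | TT T /\ closure T p].

Definition affine_on (S : set V) (f : V -> R) : Prop :=
  exists (A : 'rV[R]_d) (b : R), forall x, S x -> f x = (A *m x) 0 0 + b.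

(* The domain is closure Omega rather than Omega, as p may be a boundary
   point. *)
Definition is_hat (Omega : set V) (TT : set (set V)) (p : V) (theta : V -> R) :
    Prop :=
  [/\ {within closure Omega, continuous theta},
      forall T, TT T -> affine_on T theta,
      theta p = 1 &
      forall v, mesh_vertex TT v -> v <> p -> theta v = 0].

(* Here a lists the vertices of a simplex adjacent to p = a ord0. *)
Definition aux_point (a : 'I_d.+1 -> V) (delta : R) : V :=
  a ord0 + delta *: \sum_(i < d) (a ord0 - a (lift ord0 i)).

Definition aux_simplex (a : 'I_d.+1 -> V) (delta : R) (i : 'I_d.+1) : set V :=
  if i == ord0 then conv a
  else conv (fun k => if k == i then aux_point a delta else a k).

Definition aux_patch (a : 'I_d.+1 -> V) (delta : R) : set V :=
  \bigcup_i closure (aux_simplex a delta i).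

(* The auxiliary hat function is taken on the whole space, since for a boundary
   vertex p the point q, and hence some of the auxiliary simplices, may lie
   outside Omega. *)
Definition is_aux_hat (a : 'I_d.+1 -> V) (delta : R) (theta : V -> R) : Prop :=
  [/\ continuous theta,
      [/\ theta (a ord0) = 1, theta (aux_point a delta) = 0 &
          forall i : 'I_d, theta (a (lift ord0 i)) = 0],
      forall i, affine_on (aux_simplex a delta i) theta &
      forall x, ~ aux_patch a delta x -> theta x = 0].

End Meshes.

(* Main.v *)
Require Import Defs.
From HB Require Import structures.
From mathcomp Require Import all_boot all_order all_algebra.
From mathcomp Require Import all_classical all_reals all_analysis.
From mathcomp Require Import zify ring lra.

Set Implicit Arguments.
Unset Strict Implicit.
Unset Printing Implicit Defensive.

Import Order.TTheory GRing.Theory Num.Theory.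
Import numFieldNormedType.Exports.

Local Open Scope classical_set_scope.
Local Open Scope ring_scope.

(** Let [lam_0, ..., lam_d] be the barycentric coordinates of a simplex [T_j]
    adjacent to [p], with [lam_0] the one of [p]. The auxiliary hat function
    equals [lam_0] on [T_j] and [lam_0 + (d + 1 / delta) lam_i] on the [i]-th
    outer simplex ([aux_hat_rows]), so the [j]-th subnetwork realizes the
    maximum of [0] and [lam_0 + (d + 1 / delta) * min (0, lam_1, ..., lam_d)],
    which is [lam_0] minus a penalty for leaving [T_j] through a face that
    contains [p].

    On the closure of [T_j] there is no penalty and the subnetwork yields
    [lam_0], which is the hat function [theta] there ([aux_net_eq_hat],
    [hat_closure]). Hence the maximum over [j] is at least [theta] on the
    simplices adjacent to [p]; on the others [theta] is [0], and the maximum is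
    nonnegative anyway. What remains is that no subnetwork exceeds [theta] on a
    simplex [T'] that is not its own, provided that [delta] is small. Since
    [theta] is nonnegative, only points with [0 <= lam_0] matter.

    There the values at the common vertices of [T_j] and [T'] contribute equally
    to [lam_0] and to [theta], so [lam_0 - theta] is at most a constant times
    the total weight [m] that the point gives to the vertices of [T'] that are
    not vertices of [T_j]. The penalty beats this, because the face of [T']
    spanned by those vertices is strictly separated from [T_j]: at each of its
    points some [lam_i] belonging to a vertex of [T_j] outside [T'] is negative.
    Otherwise adding enough weight at the common vertices would give a point of
    both closed simplices that is not on their common face, against the
    regularity of the mesh ([opposite_face_separated]). Compactness turns
    [lam_i < 0] into [lam_i <= - eps * m]
    ([opposite_face_uniformly_separated]), and a factor [1 / delta] of size
    [constant / eps] suffices ([hat_penalty_bound]). The mesh has finitely many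
    pairs of simplices, so one [delta_bar] serves all
    ([mesh_hat_penalty_bound]).

    For the size, a sparse concatenation at most doubles the sizes of its
    factors and parallelization adds sizes; the affine layer of a subnetwork has
    at most [(d + 1)^2] nonzero entries and the minimum network [O(d)]. *)

(** * Networks: realization and size of the operations *)

Lemma relu_sub (R : realType) (y : R) : relu y - relu (- y) = y.
Proof.
by rewrite /relu; case: (ltP 0 y) => h; case: (ltP 0 (- y)) => h'; lra.
Qed.

(** A network of type [nn R n m 0] cannot be destructed directly, since the
    number of hidden layers is an index of the type; this inversion
    principle and [nnS_case] serve the operations on two networks of equal
    depth. *)
Lemma nn0_case (R : realType) n m (P : nn R n m 0 -> Prop) :
  (forall A b, P (nn_out A b)) -> forall phi, P phi.
Proof.
move=> H phi.
refine (match phi as p in nn _ _ _ L return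
  (match L return nn R n m L -> Prop with
   | 0 => fun p => forall P : nn R n m 0 -> Prop,
       (forall A b, P (nn_out A b)) -> P p
   | _ => fun=> True end) p with nn_out _ _ => _ | nn_hid _ _ _ _ _ _ => _ end
  P H) => //.
Qed.

Lemma nnS_case (R : realType) n m L (P : nn R n m L.+1 -> Prop) :
  (forall k A b rho (psi : nn R k m L), P (nn_hid A b rho psi)) ->
  forall phi, P phi.
Proof.
move=> H phi.
refine (match phi as p in nn _ _ _ L return
  (match L return nn R n m L -> Prop with
   | 0 => fun=> True
   | L.+1 => fun p => forall P : nn R n m L.+1 -> Prop,
       (forall k A b rho (psi : nn R k m L), P (nn_hid A b rho psi)) -> P p
   end) p with nn_out _ _ => _ | nn_hid _ _ _ _ _ _ => _ end
  P H) => //.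
Qed.

Lemma realize_split_input (R : realType) n m L (phi : nn R n m L)
    (x y : 'cV[R]_n) :
  realize (nn_split_input phi) (col_mx x y) = realize phi (x - y).
Proof.
by case: phi => [A b|L' k A b rho psi] /=; rewrite mul_row_col mulNmx mulmxBr.
Qed.

(** The inserted layer stores the positive and the negative part of the
    output of the first network, and their difference restores it
    ([relu_sub]). *)
Lemma realize_concat (R : realType) n k m L1 L2 (phi1 : nn R k m L1)
    (phi2 : nn R n k L2) (x : 'cV[R]_n) :
  realize (nn_concat phi1 phi2) x = realize phi1 (realize phi2 x).
Proof.
elim: phi2 phi1 x => {n k L2} [n k A b|n k L j A b rho psi IH] phi1 x /=;
  last exact: IH.
set y := A *m x + b.
have -> : (\col_i relu ((col_mx A (- A) *m x + col_mx b (- b)) i 0)) =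
    col_mx (\col_i relu (y i 0)) (\col_i relu ((- y) i 0)).
  rewrite mul_col_mx add_col_mx mulNmx -opprD -/y.
  apply/colP => i; rewrite mxE.
  by case: (split_ordP i) => i' ->; rewrite ?col_mxEu ?col_mxEd mxE.
rewrite realize_split_input; congr realize.
by apply/colP => i; rewrite !mxE relu_sub.
Qed.

Lemma realize_diag (R : realType) n1 n2 m1 m2 L (phi1 : nn R n1 m1 L)
    (phi2 : nn R n2 m2 L) x1 x2 :
  realize (nn_diag phi1 phi2) (col_mx x1 x2) =
  col_mx (realize phi1 x1) (realize phi2 x2).
Proof.
elim: phi1 n2 phi2 x1 x2 =>
  {n1 m1 L} [n1 m1 A1 b1|n1 m1 L k1 A1 b1 rho1 psi1 IH] n2.
  apply: nn0_case => A2 b2 x1 x2 /=.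
  by rewrite mul_block_col !mul0mx addr0 add0r add_col_mx.
apply: nnS_case => k2 A2 b2 rho2 psi2 x1 x2 /=.
rewrite -IH; congr realize.
rewrite mul_block_col !mul0mx addr0 add0r add_col_mx.
apply/colP => i; rewrite !mxE.
by case: (fintype.split i) => i'; rewrite !mxE.
Qed.

Lemma realize_par (R : realType) n m1 m2 L (phi1 : nn R n m1 L)
    (phi2 : nn R n m2 L) x :
  realize (nn_par phi1 phi2) x = col_mx (realize phi1 x) (realize phi2 x).
Proof.
case: phi1 phi2 => {L} [A1 b1|L k1 A1 b1 rho1 psi1].
  apply: nn0_case => A2 b2 /=.
  by rewrite mul_col_mx add_col_mx.
apply: nnS_case => k2 A2 b2 rho2 psi2 /=.
rewrite -realize_diag; congr realize.
rewrite mul_col_mx add_col_mx.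
apply/colP => i; rewrite !mxE.
by case: (fintype.split i) => i'; rewrite !mxE.
Qed.

Lemma realize_pars (R : realType) n L s (phi : 'I_s.+1 -> nn R n 1 L) x j :
  realize (nn_pars phi) x j 0 = realize (phi j) x 0 0.
Proof.
elim: s phi j => [|s IH] phi j /=; first by rewrite (ord1 j).
rewrite (realize_par (phi ord0) (nn_pars (fun j => phi (lift ord0 j)))).
case: (unliftP ord0 j) => [j' ->|->].
  have -> : lift ord0 j' = rshift 1 j' by apply/val_inj.
  rewrite (@col_mxEd _ 1 s.+1 1) IH.
  by congr (realize (phi _) x 0 0); apply/val_inj.
have -> : ord0 = lshift s.+1 (ord0 : 'I_1) by apply/val_inj.
by rewrite (@col_mxEu _ 1 s.+1 1); congr (realize (phi _) x _ 0); apply/val_inj.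
Qed.

Lemma norm0_sum (R : realType) p q (A : 'M[R]_(p, q)) :
  norm0 A = (\sum_i \sum_j (A i j != 0%R))%N.
Proof. by rewrite /norm0 -sum1_card big_mkcond pair_bigA. Qed.

Lemma norm0_le (R : realType) p q (A : 'M[R]_(p, q)) : (norm0 A <= p * q)%N.
Proof. by apply: leq_trans (max_card _) _; rewrite card_prod !card_ord. Qed.

Lemma norm0_const0 (R : realType) p q : norm0 (0 : 'M[R]_(p, q)) = 0%N.
Proof.
by rewrite norm0_sum big1 // => i _; rewrite big1 // => j _; rewrite mxE eqxx.
Qed.

Lemma norm0N (R : realType) p q (A : 'M[R]_(p, q)) : norm0 (- A) = norm0 A.
Proof.
rewrite !norm0_sum; apply: eq_bigr => i _; apply: eq_bigr => j _.
by rewrite mxE oppr_eq0.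
Qed.

Lemma norm0_col_mx (R : realType) p1 p2 q (A : 'M[R]_(p1, q))
    (B : 'M[R]_(p2, q)) : norm0 (col_mx A B) = (norm0 A + norm0 B)%N.
Proof.
rewrite !norm0_sum big_split_ord /=; congr (_ + _)%N;
  by apply: eq_bigr => i _; apply: eq_bigr => j _; rewrite ?col_mxEu ?col_mxEd.
Qed.

Lemma norm0_row_mx (R : realType) p q1 q2 (A : 'M[R]_(p, q1))
    (B : 'M[R]_(p, q2)) : norm0 (row_mx A B) = (norm0 A + norm0 B)%N.
Proof.
rewrite !norm0_sum -big_split /=; apply: eq_bigr => i _.
rewrite big_split_ord /=; congr (_ + _)%N;
  by apply: eq_bigr => j _; rewrite ?row_mxEl ?row_mxEr.
Qed.

Lemma norm0_block_diag (R : realType) p1 p2 q1 q2 (A : 'M[R]_(p1, q1))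
    (B : 'M[R]_(p2, q2)) : norm0 (block_mx A 0 0 B) = (norm0 A + norm0 B)%N.
Proof. by rewrite norm0_col_mx !norm0_row_mx !norm0_const0 addn0. Qed.

Lemma nn_size_split_input (R : realType) n m L (phi : nn R n m L) :
  (nn_size (nn_split_input phi) <= 2 * nn_size phi)%N.
Proof.
by case: phi => [A b|L' k A b rho psi] /=; rewrite norm0_row_mx norm0N; lia.
Qed.

(** The last layer of [phi2] and the first weight matrix of [phi1] occur
    twice, everything else once. *)
Lemma nn_size_concat (R : realType) n k m L1 L2 (phi1 : nn R k m L1)
    (phi2 : nn R n k L2) :
  (nn_size (nn_concat phi1 phi2) <= 2 * nn_size phi1 + 2 * nn_size phi2)%N.
Proof.
elim: phi2 phi1 => {n k L2} [n k A b|n k L j A b rho psi IH] phi1 /=.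
  rewrite !norm0_col_mx !norm0N.
  by have := nn_size_split_input phi1; lia.
by have := IH phi1; lia.
Qed.

Lemma nn_size_diag (R : realType) n1 n2 m1 m2 L (phi1 : nn R n1 m1 L)
    (phi2 : nn R n2 m2 L) :
  nn_size (nn_diag phi1 phi2) = (nn_size phi1 + nn_size phi2)%N.
Proof.
elim: phi1 n2 phi2 =>
  {n1 m1 L} [n1 m1 A1 b1|n1 m1 L k1 A1 b1 rho1 psi1 IH] n2.
  apply: nn0_case => A2 b2 /=.
  by rewrite norm0_block_diag norm0_col_mx addnACA.
apply: nnS_case => k2 A2 b2 rho2 psi2 /=.
by rewrite IH norm0_block_diag norm0_col_mx; lia.
Qed.

Lemma nn_size_par (R : realType) n m1 m2 L (phi1 : nn R n m1 L)
    (phi2 : nn R n m2 L) :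
  nn_size (nn_par phi1 phi2) = (nn_size phi1 + nn_size phi2)%N.
Proof.
case: phi1 phi2 => {L} [A1 b1|L k1 A1 b1 rho1 psi1].
  by apply: nn0_case => A2 b2 /=; rewrite !norm0_col_mx addnACA.
apply: nnS_case => k2 A2 b2 rho2 psi2 /=.
by rewrite nn_size_diag !norm0_col_mx; lia.
Qed.

Lemma nn_size_pars (R : realType) n L s (phi : 'I_s.+1 -> nn R n 1 L) :
  nn_size (nn_pars phi) = (\sum_j nn_size (phi j))%N.
Proof.
elim: s phi => [|s IH] phi /=; first by rewrite big_ord1.
by rewrite (nn_size_par (phi ord0)) [RHS]big_ord_recl IH.
Qed.

Lemma realize_relu1 (R : realType) (y : 'cV[R]_1) :
  realize (@nn_relu1 R) y 0 0 = relu (y 0 0).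
Proof. by rewrite /= !mul1mx !addr0 mxE. Qed.

Lemma realize_aux_hat (R : realType) d (L : nat -> nat)
    (Phimin : forall n, nn R n 1 (L n)) (A : 'M[R]_(d.+1, d)) (b : 'cV[R]_d.+1)
    x :
  realize (nn_aux_hat Phimin A b) x 0 0 =
  relu (realize (Phimin d.+1) (A *m x + b) 0 0).
Proof. by rewrite /nn_aux_hat !realize_concat realize_relu1. Qed.

Lemma nn_size_relu1 (R : realType) : (nn_size (@nn_relu1 R) <= 2)%N.
Proof.
rewrite /= !norm0_const0 !addn0 -[2%N]/(1 * 1 + 1 * 1)%N.
by rewrite leq_add // norm0_le.
Qed.

Lemma nn_size_aux_hat (R : realType) d (L : nat -> nat)
    (Phimin : forall n, nn R n 1 (L n)) (A : 'M[R]_(d.+1, d))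
    (b : 'cV[R]_d.+1) :
  (nn_size (nn_aux_hat Phimin A b) <=
     4 + 4 * nn_size (Phimin d.+1) + 4 * (d.+1 * d.+1))%N.
Proof.
have Eout : nn_size (nn_out A b) = (norm0 A + norm0 b)%N by [].
have h1 := nn_size_concat (@nn_relu1 R) (nn_concat (Phimin d.+1) (nn_out A b)).
have h2 := nn_size_concat (Phimin d.+1) (nn_out A b).
rewrite Eout in h2.
have h3 := nn_size_relu1 R; have h4 := norm0_le A; have h5 := norm0_le b.
set z := nn_size (nn_concat (Phimin d.+1) _) in h1 h2.
apply: leq_trans h1 _.
by move: z h2 h3 h4 h5 => z; rewrite muln1; nia.
Qed.

(** * Affine functions and barycentric coordinates *)

(** Affine functions preserve affine combinations. All the comparisons of
    barycentric coordinates below reduce to this. *)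
Lemma affine_comb (R : realType) d (f : 'cV[R]_d -> R) (I : finType)
    (mu : I -> R) (c : I -> 'cV[R]_d) :
  affine_on setT f -> \sum_i mu i = 1 ->
  f (\sum_i mu i *: c i) = \sum_i mu i * f (c i).
Proof.
move=> [A [b fE]] mu1; rewrite fE // mulmx_sumr summxE.
rewrite -[b]mul1r -mu1 mulr_suml -big_split /=; apply: eq_bigr => i _.
by rewrite fE // -scalemxAr mxE mulrDr.
Qed.

Lemma affine_onN (R : realType) d (f : 'cV[R]_d -> R) :
  affine_on setT f -> affine_on setT (fun x => - f x).
Proof.
move=> [A [b fE]]; exists (- A), (- b) => x _.
by rewrite fE // mulNmx [in RHS]mxE opprD.
Qed.

Lemma continuous_sum (R : realType) (T : topologicalType) (I : finType)
    (F : I -> T -> R) :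
  (forall i, continuous (F i)) -> continuous (fun x => \sum_i F i x).
Proof.
move=> cF x; apply: cvg_big => [|i _]; last exact: cF.
exact: add_continuous.
Qed.

Lemma affine_continuous (R : realType) d (f : 'cV[R]_d -> R) :
  affine_on setT f -> continuous f.
Proof.
move=> [A [b fE]].
have -> : f = (fun x => \sum_k A 0 k * x k 0 + b).
  by apply/funext => x; rewrite fE // mxE.
move=> x; apply: continuousD; last exact: cst_continuous.
apply: continuous_sum => k {}x.
by apply: continuousM; [exact: cst_continuous|exact: coord_continuous].
Qed.

Lemma linear_affine (R : realType) d (f : {linear 'cV[R]_d -> R^o}) c :
  affine_on setT (fun x => f (x - c)).
Proof.
exists (\row_k f (delta_mx k 0)), (- f c) => x _.
rewrite linearB /=; congr (_ - _).
rewrite {1}(matrix_sum_delta x) linear_sum /= mxE.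
apply: eq_bigr => k _; rewrite big_ord1 linearZ /= !mxE.
by rewrite mulrC.
Qed.

(** The barycentric coordinates: those of [x - a ord0] in the basis of the
    edges at [a ord0], and for [a ord0] itself the one that makes the sum
    equal to 1. Meaningful for an affinely independent family of points. *)
Definition bary (R : realType) d (a : 'I_d.+1 -> 'cV[R]_d) (i : 'I_d.+1)
    (x : 'cV[R]_d) : R :=
  let co k := coord [tuple a (lift ord0 i) - a ord0 | i < d] k (x - a ord0) in
  if unlift ord0 i is Some k then co k else 1 - \sum_k co k.

Lemma bary_affine (R : realType) d (a : 'I_d.+1 -> 'cV[R]_d) i :
  affine_on setT (bary a i).
Proof.
rewrite /bary; case: (unlift ord0 i) => [k|]; first exact: linear_affine.
set X := [tuple _ | _ < _].
have /boolp.choice[A /boolp.choice[b fE]] k :=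
  linear_affine (coord X k) (a ord0).
exists (- \sum_k A k), (1 - \sum_k b k) => x _.
rewrite mulNmx mulmx_suml mxE summxE.
rewrite addrCA -opprD -big_split /=; congr (_ - _).
by apply: eq_bigr => k _; rewrite fE.
Qed.

Lemma bary_sum (R : realType) d (a : 'I_d.+1 -> 'cV[R]_d) x :
  \sum_i bary a i x = 1.
Proof.
rewrite big_ord_recl /bary unlift_none.
rewrite [X in _ + X](_ : _ = \sum_(k < d)
  coord [tuple a (lift ord0 i) - a ord0 | i < d] k (x - a ord0)) ?subrK //.
by apply: eq_bigr => k _; rewrite liftK.
Qed.

Lemma bary_comb (R : realType) d (a : 'I_d.+1 -> 'cV[R]_d) x :
  aff_indep a -> \sum_i bary a i x *: a i = x.
Proof.
rewrite /aff_indep; set X := [tuple _ | _ < _] => Xfree.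
have Xbasis : basis_of fullv X.
  by rewrite basisEfree Xfree subvf size_tuple dimvf dim_matrix mulr1 leqnn.
apply: (addIr (- a ord0)).
rewrite [RHS](coord_basis Xbasis (memvf (x - a ord0))).
rewrite big_ord_recl /bary unlift_none -/X scalerBl scale1r scaler_suml.
rewrite addrAC [a ord0 - _]addrC addrK addrC -sumrB.
apply: eq_bigr => k _.
by rewrite liftK -tnth_nth tnth_mktuple -scalerBr.
Qed.

Lemma bary_coef (R : realType) d (a : 'I_d.+1 -> 'cV[R]_d) mu i :
  aff_indep a -> \sum_k mu k = 1 -> bary a i (\sum_k mu k *: a k) = mu i.
Proof.
rewrite /aff_indep => Xfree mu1.
set X := [tuple _ | _ < _] in Xfree.
have E : \sum_k mu k *: a k - a ord0 = \sum_(k < d) mu (lift ord0 k) *: X`_k.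
  rewrite -[a ord0 in LHS]scale1r -mu1 scaler_suml -sumrB.
  rewrite big_ord_recl subrr add0r.
  by apply: eq_bigr => k _; rewrite -tnth_nth tnth_mktuple scalerBr.
have C k : coord X k (\sum_k mu k *: a k - a ord0) = mu (lift ord0 k).
  by rewrite E coord_sum_free.
rewrite /bary -/X; case: (unliftP ord0 i) => [k ->|->]; first exact: C.
rewrite (eq_bigr _ (fun k _ => C k)) -mu1 big_ord_recl; lra.
Qed.

Lemma bary_vertex (R : realType) d (a : 'I_d.+1 -> 'cV[R]_d) i k :
  aff_indep a -> bary a i (a k) = (i == k)%:R.
Proof.
move=> aI; rewrite -[a k](_ : \sum_l (l == k)%:R *: a l = _).
  rewrite bary_coef // (bigD1 k) //= eqxx big1 ?addr0 // => l /negbTE -> //.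
rewrite (bigD1 k) //= eqxx scale1r big1 ?addr0 // => l /negbTE ->.
by rewrite scale0r.
Qed.

Lemma aff_indep_inj (R : realType) d (a : 'I_d.+1 -> 'cV[R]_d) :
  aff_indep a -> injective a.
Proof.
move=> aI i k E; have := bary_vertex i k aI; rewrite -E bary_vertex // eqxx.
by case: eqP => // _ /eqP; rewrite oner_eq0.
Qed.

(** * Closed simplices and their vertices *)

(** A limit along [S] determines the value at a point of its closure. Since
    a hat function is given as affine on open simplices only, this is what
    gives access to its values on faces and at vertices. *)
Lemma within_continuous_eq_closure (R : realType) (T : topologicalType)
    (W S : set T) (f g : T -> R) :
  {within W, continuous f} -> continuous g -> S `<=` W ->
  {in S, f =1 g} -> {in closure S `&` W, f =1 g}.
Proof.
move=> cf cg SW fg x /set_mem[clSx Wx].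
have FF : ProperFilter (within S (nbhs x)) by exact: within_nbhs_proper.
have cgx : g @ within S (nbhs x) --> g x.
  by apply: cvg_trans (cg x); apply: cvg_app; exact: cvg_within.
have cfx : g @ within S (nbhs x) --> f x.
  apply: (@cvg_trans _ (f @ within S (nbhs x))).
    by apply: (@fmap_within_eq _ S _ (nbhs x) g f) => y yS; rewrite fg.
  move/subspace_continuousP : cf => /(_ x Wx); apply: cvg_trans.
  by apply: cvg_app; exact: within_subset.
exact: (cvg_unique (@norm_hausdorff _ _) cfx cgx).
Qed.

(** Weights that vanish are allowed in the closure: the segment to the
    barycenter has positive weights except at its starting point. *)
Lemma closure_conv_comb (R : realType) d (I : finType) (c : I -> 'cV[R]_d)
    (mu : I -> R) :
  (forall i, 0 <= mu i) -> \sum_i mu i = 1 ->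
  closure (Defs.conv c) (\sum_i mu i *: c i).
Proof.
move=> mu0 mu1; set x := \sum_i _.
have I0 : (0 < #|I|)%N.
  rewrite lt0n; apply/eqP => I0; move: mu1; rewrite big1 => [/esym/eqP|i _].
    by rewrite oner_eq0.
  by have := card0_eq I0 i; rewrite !inE.
have nI0 : 0 < (#|I|%:R : R) by rewrite ltr0n.
pose w i t : R := mu i + t * (#|I|%:R^-1 - mu i).
pose y := \sum_i (#|I|%:R^-1 - mu i) *: c i.
have path t : x + t *: y = \sum_i w i t *: c i.
  rewrite /x /y scaler_sumr -big_split /=; apply: eq_bigr => i _.
  by rewrite /w [RHS]scalerDl scalerA.
have inconv t : 0 < t -> t < 1 -> Defs.conv c (x + t *: y).
  move=> t0 t1; exists (w^~ t); split => // [i|].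
    have : 0 < (#|I|%:R^-1 : R) by rewrite invr_gt0.
    by have := mu0 i; rewrite /w; nra.
  rewrite /w big_split /= mu1 -mulr_sumr sumrB mu1 sumr_const.
  by rewrite -[_ *+ _]mulr_natr mulVf ?subrr ?mulr0 ?addr0 // gt_eqF.
move=> B xB.
have cpath : x + t *: y @[t --> (0:R)^'+] --> x.
  rewrite -[X in _ --> X]addr0 -(scale0r y).
  apply: cvg_at_right_filter; apply: cvgD; first exact: cvg_cst.
  by apply: cvgZr_tmp; exact: cvg_id.
have : \forall t \near (0:R)^'+, [/\ B (x + t *: y), 0 < t & t < 1].
  near=> t; split.
  - by near: t; exact: cpath.
  - by near: t; exact: nbhs_right_gt.
  - by near: t; exact: nbhs_right_lt.
move/filter_ex => [t [Bt t0 t1]]; exists (x + t *: y).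
by split => //; exact: inconv.
Unshelve. all: end_near. Qed.

Lemma closure_conv_vertex (R : realType) d (I : finType) (c : I -> 'cV[R]_d) k :
  closure (Defs.conv c) (c k).
Proof.
rewrite -[c k](_ : \sum_l (l == k)%:R *: c l = _).
  apply: closure_conv_comb => [i|]; first by case: eqP.
  by rewrite (bigD1 k) //= eqxx big1 ?addr0 // => l /negbTE ->.
rewrite (bigD1 k) //= eqxx scale1r big1 ?addr0 // => l /negbTE ->.
by rewrite scale0r.
Qed.

Lemma affine_ge0_closure_conv (R : realType) d (I : finType)
    (c : I -> 'cV[R]_d) f x :
  affine_on setT f -> (forall i, 0 <= f (c i)) -> closure (Defs.conv c) x ->
  0 <= f x.
Proof.
move=> fa fc.
suff: closure (Defs.conv c) `<=` [set x | 0 <= f x] by apply.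
have cl : closed [set x | 0 <= f x].
  apply: (@closed_comp _ _ f [set y | 0 <= y]); last exact: closed_ge.
  by move=> ? _; exact: affine_continuous.
rewrite [X in _ `<=` X](closure_id _).1 //.
apply: closureS => _ [lam [lam0 lam1 ->]] /=.
rewrite (affine_comb _ fa) //; apply: sumr_ge0 => i _.
by rewrite mulr_ge0 // ltW.
Qed.

Lemma affine_eq0_closure_conv (R : realType) d (I : finType)
    (c : I -> 'cV[R]_d) f x :
  affine_on setT f -> (forall i, f (c i) = 0) -> closure (Defs.conv c) x ->
  f x = 0.
Proof.
move=> fa fc clx; apply/le_anti/andP; split; last first.
  by apply: affine_ge0_closure_conv clx => // i; rewrite fc.
rewrite -oppr_ge0; apply: affine_ge0_closure_conv (affine_onN fa) _ clx => i.
by rewrite fc oppr0.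
Qed.

(** The coordinates are continuous and nonnegative on the open simplex,
    hence on its closure; conversely they are the weights of a combination. *)
Lemma closure_conv_bary (R : realType) d (a : 'I_d.+1 -> 'cV[R]_d) x :
  aff_indep a -> closure (Defs.conv a) x <-> forall i, 0 <= bary a i x.
Proof.
move=> aI; split => [clx i|x0].
  apply: affine_ge0_closure_conv clx; first exact: bary_affine.
  by move=> k; rewrite bary_vertex.
rewrite -(bary_comb x aI); apply: closure_conv_comb => //.
exact: bary_sum.
Qed.

(** A vertex is an extreme point. If [a i] is a convex combination of points
    [c j] of the closed simplex of [a], each [c j] of positive weight must
    have coordinate 0 at every [a k] with [k] different from [i], so it is
    [a i]. *)
Lemma extreme_vertex (R : realType) d (a c : 'I_d.+1 -> 'cV[R]_d) i :
  aff_indep a -> aff_indep c -> closure (Defs.conv c) (a i) ->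
  (forall j, 0 < bary c j (a i) -> closure (Defs.conv a) (c j)) ->
  exists j, a i = c j.
Proof.
move=> aI cI /(closure_conv_bary _ cI) mu0 nu.
have nu0 k j : 0 <= bary c j (a i) * bary a k (c j).
  have [->|muj] := eqVneq (bary c j (a i)) 0; first by rewrite mul0r.
  rewrite mulr_ge0 // (closure_conv_bary _ aI).1 //; apply: nu.
  by rewrite lt_neqAle eq_sym muj mu0.
have [j muj] : exists j, 0 < bary c j (a i).
  apply/existsP; apply: contraPT (bary_sum c (a i)) => /existsPn H.
  rewrite big1 => [/eqP|j _]; first by rewrite eq_sym oner_eq0.
  by apply/le_anti; rewrite mu0 andbT leNgt H.
exists j.
have nuj k : k != i -> bary a k (c j) = 0.
  move=> ki.
  have /eqP := bary_vertex k i aI; rewrite (negbTE ki).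
  rewrite -{1}(bary_comb (a i) cI) (affine_comb _ (bary_affine a k));
    last exact: bary_sum.
  rewrite psumr_eq0 // => /allP/(_ j); rewrite mem_index_enum => /(_ isT) /=.
  by rewrite mulf_eq0 (gt_eqF muj) => /eqP.
rewrite -(bary_comb (c j) aI) (bigD1 i) //= big1 => [|k /nuj ->]; last first.
  by rewrite scale0r.
have := bary_sum a (c j); rewrite (bigD1 i) //= big1 => [|k /nuj -> //].
by rewrite addr0 => ->; rewrite scale1r addr0.
Qed.

(** A simplex determines its vertices up to order. The mesh is a set of
    sets, so enumerations of the vertices of the same simplex come from
    several sources and have to be matched. *)
Lemma conv_vertices (R : realType) d (a c : 'I_d.+1 -> 'cV[R]_d) i :
  aff_indep a -> aff_indep c -> Defs.conv a = Defs.conv c ->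
  exists j, a i = c j.
Proof.
move=> aI cI E; apply: extreme_vertex => // [|j _].
  by rewrite -E; exact: closure_conv_vertex.
by rewrite E; exact: closure_conv_vertex.
Qed.

Lemma bary_reindex (R : realType) d (a c : 'I_d.+1 -> 'cV[R]_d) i j x :
  aff_indep a -> aff_indep c -> Defs.conv a = Defs.conv c -> a i = c j ->
  bary a i x = bary c j x.
Proof.
move=> aI cI E ij.
rewrite -{1}(bary_comb x cI) (affine_comb _ (bary_affine a i)) ?bary_sum //.
rewrite (bigD1 j) //= -ij bary_vertex // eqxx mulr1 big1 ?addr0 // => k kj.
have [l El] := conv_vertices k cI aI (esym E).
rewrite El bary_vertex //; case: eqP => [il|]; last by rewrite mulr0.
by case/eqP: kj; apply: (aff_indep_inj cI); rewrite El -il.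
Qed.

(** * Simplices meeting along a common face *)

(** What regularity of the mesh says in coordinates: a common point of two
    closed simplices lies on the face of the second one spanned by the
    common vertices. *)
Definition meet_along_shared_face (R : realType) d
    (e e' : 'I_d.+1 -> 'cV[R]_d) : Prop :=
  forall x l, closure (Defs.conv e) x -> closure (Defs.conv e') x ->
  (forall i, e i != e' l) -> bary e' l x = 0.

(** A common subsimplex is given by two lists of points, [c] of vertices of
    [T] and [c'] of vertices of [T']. A vertex [e' l] in the list [c'] is an
    extreme point of [T'], hence of the subsimplex, hence a vertex of [T];
    if [e' l] is not in the list, its coordinate vanishes on the subsimplex. *)
Lemma mesh_meet_along_shared_face (R : realType) d (Omega : set 'cV[R]_d) TT
    T T' e e' :
  regular_simplicial_partition Omega TT -> TT T -> TT T' ->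
  is_simplex e T -> is_simplex e' T' -> meet_along_shared_face e e'.
Proof.
move=> [_ _ _ _ meet] TTT TTT' [eI TE] [e'I TE'] x l clx clx' nsh.
have [ET|NT] := pselect (T = T').
  have Econv : Defs.conv e' = Defs.conv e by rewrite -TE -TE' ET.
  have [j Ej] := conv_vertices l e'I eI Econv.
  by have := nsh j; rewrite Ej eqxx.
have {meet} := meet _ _ TTT TTT' NT.
rewrite TE TE' => -[S0|[S [[k [c [_ cT SE]]] [k' [c' [_ cT' SE']]] SI]]].
  by exfalso; suff : set0 x by []; rewrite -S0.
have cE m : exists i, c m = e i.
  have [a [i [[aI aE] ->]]] := cT m.
  exact: conv_vertices aI eI (esym aE).
have cE' m : exists i, c' m = e' i.
  have [a [i [[aI aE] ->]]] := cT' m.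
  exact: conv_vertices aI e'I (esym aE).
have clS y : closure S y -> closure (Defs.conv e) y /\ closure (Defs.conv e') y.
  by rewrite -SI.
have Sx : closure S x by rewrite -SI.
have [[m Em]|Nm] := pselect (exists m, c' m = e' l); last first.
  rewrite SE' in Sx; apply: affine_eq0_closure_conv Sx.
    exact: bary_affine.
  move=> m; have [i Ei] := cE' m; rewrite Ei bary_vertex //.
  by case: eqP => // li; case: Nm; exists m; rewrite Ei li.
have Se'l : closure S (e' l) by rewrite -Em SE'; exact: closure_conv_vertex.
have [i Ei] : exists i, e' l = e i.
  apply: extreme_vertex => // [|i bi]; first by have [] := clS _ Se'l.
  have [[n En]|Nn] := pselect (exists n, c n = e i).
    have [] // := clS (e i).
    by rewrite -En SE; exact: closure_conv_vertex.
  exfalso; move: bi; rewrite SE in Se'l.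
  rewrite (affine_eq0_closure_conv (bary_affine e i) _ Se'l) ?ltxx // => n.
  have [j Ej] := cE n; rewrite Ej bary_vertex //.
  by case: eqP => // ij; case: Nn; exists n; rewrite Ej ij.
by have := nsh i; rewrite Ei eqxx.
Qed.

Definition listed (R : realType) d (e : 'I_d.+1 -> 'cV[R]_d) v : bool :=
  [exists i, e i == v].

(** If all coordinates at the vertices of [e] outside [e'] were nonnegative
    at a point [z] spanned by the vertices of [e'] outside [e], then adding
    a large weight [N] at each common vertex would make the remaining
    coordinates nonnegative as well. The resulting point lies in both closed
    simplices, but not on their common face. *)
Lemma opposite_face_separated (R : realType) d (e e' : 'I_d.+1 -> 'cV[R]_d)
    (nu : 'I_d.+1 -> R) :
  aff_indep e -> aff_indep e' -> meet_along_shared_face e e' ->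
  (forall l, 0 <= nu l) -> \sum_l nu l = 1 ->
  (forall l, listed e (e' l) -> nu l = 0) ->
  exists2 i, ~~ listed e' (e i) & bary e i (\sum_l nu l *: e' l) < 0.
Proof.
move=> eI e'I meet nu0 nu1 nush; set z := \sum_l _.
apply: contrapT => H.
have zge i : ~~ listed e' (e i) -> 0 <= bary e i z.
  by move=> ni; rewrite leNgt; apply/negP => zi; apply: H; exists i.
(* N is large enough to compensate every negative coordinate of z; D is the
   total weight after the addition. *)
pose N := \sum_i `|bary e i z|.
have Nge i : - bary e i z <= N.
  rewrite /N (bigD1 i) //=; apply: le_trans (ler_norm _) _.
  by rewrite normrN lerDl sumr_ge0.
have N0 : 0 <= N by rewrite /N sumr_ge0.
pose D := 1 + N * \sum_l (listed e (e' l))%:R.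
have D0 : 0 < D.
  by rewrite /D ltr_wpDr // mulr_ge0 // sumr_ge0 // => l _; rewrite ler0n.
pose w l := (nu l + N * (listed e (e' l))%:R) / D.
have w0 l : 0 <= w l.
  by rewrite /w divr_ge0 ?(ltW D0) // addr_ge0 // mulr_ge0.
have w1 : \sum_l w l = 1.
  by rewrite /w -mulr_suml big_split /= nu1 -mulr_sumr mulfV ?gt_eqF.
pose x := \sum_l w l *: e' l.
have clx' : closure (Defs.conv e') x by exact: closure_conv_comb.
have clx : closure (Defs.conv e) x.
  apply/(closure_conv_bary _ eI) => i.
  rewrite /x (affine_comb _ (bary_affine e i)) //.
  have -> : \sum_l w l * bary e i (e' l) =
      (bary e i z + N * \sum_(l | listed e (e' l)) bary e i (e' l)) / D.
    rewrite /z (affine_comb _ (bary_affine e i)) //.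
    rewrite [X in N * X]big_mkcond [N * _]mulr_sumr.
    rewrite -big_split /= mulr_suml; apply: eq_bigr => l _.
    by rewrite /w; case: ifP => _ /=; ring.
  rewrite divr_ge0 ?(ltW D0) //.
  have sh0 l : listed e (e' l) -> 0 <= bary e i (e' l).
    by move=> /existsP[k /eqP <-]; rewrite bary_vertex.
  have [/existsP[l /eqP El]|ni] := boolP (listed e' (e i)); last first.
    by rewrite addr_ge0 ?zge // mulr_ge0 // sumr_ge0.
  have shl : listed e (e' l) by apply/existsP; exists i; rewrite El.
  rewrite (bigD1 l) //= {1}El bary_vertex // eqxx mulrDr mulr1 addrA.
  rewrite addr_ge0 //.
    by have := Nge i; lra.
  by rewrite mulr_ge0 // sumr_ge0 // => k /andP[/sh0].
have nul l : nu l = 0.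
  have [/nush //|nl] := boolP (listed e (e' l)).
  have : bary e' l x = 0.
    apply: meet => // i; apply: contraNneq nl => Ei.
    by apply/existsP; exists i; rewrite Ei.
  rewrite /x bary_coef // /w (negbTE nl) mulr0 addr0 => /eqP.
  by rewrite mulf_eq0 invr_eq0 (gt_eqF D0) orbF => /eqP.
by move: nu1; rewrite big1 // => /esym/eqP; rewrite oner_eq0.
Qed.

(** The minimum is attained; on the empty set any bound will do. *)
Lemma compact_pos_lower_bound (R : realType) (T : topologicalType)
    (A : set T) (h : T -> R) :
  compact A -> continuous h -> (forall x, A x -> 0 < h x) ->
  exists2 eps, 0 < eps & forall x, A x -> eps <= h x.
Proof.
move=> cA ch h0.
have [A0|/set0P An] := eqVneq A set0; first by exists 1 => // x; rewrite A0.
have [c /set_mem Ac hc] := compact_EVT_min An cA (continuous_subspaceT ch).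
by exists (h c); [exact: h0|move=> x Ax; apply: hc; exact: mem_set].
Qed.

Lemma compact_standard_face (R : realType) n (P : pred 'I_n) :
  compact [set nu : 'rV[R]_n | [/\ forall l, 0 <= nu 0 l, \sum_l nu 0 l = 1 &
                                   forall l, P l -> nu 0 l = 0]].
Proof.
set A := [set _ | _].
have AE : A = (\bigcap_l [set nu : 'rV[R]_n | 0 <= nu 0 l]) `&`
    [set nu : 'rV[R]_n | \sum_l nu 0 l = 1] `&`
    \bigcap_(l in [set l | P l]) [set nu : 'rV[R]_n | nu 0 l = 0].
  apply/seteqP; split => [nu [nu0 nu1 nuP]|nu [[nu0 nu1] nuP]].
    by split; [split => // l _; exact: nu0|move=> l /= /nuP].
  by split => // l; exact: nu0.
apply: bounded_closed_compact.
  exists 1; split => // M M1 nu [nu0 nu1 _] /=.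
  apply: le_trans (ltW M1).
  rewrite [X in X <= _]mx_normrE; apply: bigmax_le => //= -[i l] _ /=.
  rewrite (ord1 i) ger0_norm // -nu1 (bigD1 l) //= lerDl sumr_ge0 // => k _.
rewrite AE; apply: closedI; first apply: closedI.
- apply: closed_bigI => l _.
  apply: (@closed_comp _ _ (fun nu : 'rV[R]_n => nu 0 l) [set y | 0 <= y]).
    by move=> nu _; exact: coord_continuous.
  exact: closed_ge.
- apply: (@closed_comp _ _ (fun nu : 'rV[R]_n => \sum_l nu 0 l) [set 1]).
    by move=> nu _; apply: continuous_sum => l; exact: coord_continuous.
  exact: closed_eq.
- apply: closed_bigI => l _.
  apply: (@closed_comp _ _ (fun nu : 'rV[R]_n => nu 0 l) [set 0]).
    by move=> nu _; exact: coord_continuous.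
  exact: closed_eq.
Qed.

(** The sum [h] of the negative parts of the relevant coordinates is
    continuous and, by [opposite_face_separated], positive on the compact
    face of weights of sum 1. One of its at most [d + 1] terms has at least
    the average size; the general case follows by homogeneity. *)
Lemma opposite_face_uniformly_separated (R : realType) d
    (e e' : 'I_d.+1 -> 'cV[R]_d) :
  aff_indep e -> aff_indep e' -> meet_along_shared_face e e' ->
  exists2 eps : R, 0 < eps & forall nu : 'I_d.+1 -> R,
    (forall l, 0 <= nu l) -> (forall l, listed e (e' l) -> nu l = 0) ->
    0 < \sum_l nu l ->
    exists2 i, ~~ listed e' (e i) &
      \sum_l nu l * bary e i (e' l) <= - eps * \sum_l nu l.
Proof.
move=> eI e'I meet.
pose g i (nu : 'rV[R]_d.+1) := \sum_l nu 0 l * bary e i (e' l).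
pose h nu := \sum_(i | ~~ listed e' (e i)) Num.max 0 (- g i nu).
have cg i : continuous (g i).
  apply: continuous_sum => l nu.
  apply: (@continuousM _ _ (fun nu : 'rV[R]_d.+1 => nu 0 l)).
    exact: coord_continuous.
  exact: cst_continuous.
have ch : continuous h.
  have -> : h = (fun nu => \sum_i
      if ~~ listed e' (e i) then Num.max 0 (- g i nu) else 0).
    by apply/funext => nu; rewrite /h big_mkcond.
  apply: continuous_sum => i; case: (listed e' (e i)) => /= nu.
    exact: cst_continuous.
  apply: (@continuous_max _ _ (fun=> 0) (fun nu => - g i nu)).
    exact: cst_continuous.
  by apply: (@continuousN _ _ _ (g i)); exact: cg.
have [|eps eps0 epsP] := compact_pos_lower_bound
    (@compact_standard_face R _ (fun l => listed e (e' l))) ch.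
  move=> nu [nu0 nu1 nuP].
  have [i ni] := opposite_face_separated eI e'I meet nu0 nu1 nuP.
  rewrite (affine_comb _ (bary_affine e i)) // => gi.
  rewrite /h (bigD1 i) //= ltr_pwDl // ?lt_max ?oppr_gt0 ?gi ?orbT //.
  by rewrite sumr_ge0 // => k _; rewrite le_max lexx.
exists (eps / d.+1%:R) => [|nu nu0 nuP nu1]; first by rewrite divr_gt0.
set W := \sum_l nu l in nu1 *.
apply: contrapT => H.
have gE i : g i (\row_l (nu l / W)) = (\sum_l nu l * bary e i (e' l)) / W.
  rewrite /g mulr_suml; apply: eq_bigr => l _; rewrite mxE; ring.
have : eps <= h (\row_l (nu l / W)).
  apply: epsP; split => [l||l Pl].
  - by rewrite mxE divr_ge0 // ltW.
  - rewrite -[RHS](mulfV (lt0r_neq0 nu1)) /W mulr_suml.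
    by apply: eq_bigr => l _; rewrite mxE.
  - by rewrite mxE nuP ?mul0r.
apply/negP; rewrite -ltNge.
have -> : eps = \sum_(i < d.+1) eps / d.+1%:R.
  by rewrite sumr_const card_ord -[_ *+ _]mulr_natr divfK // pnatr_eq0.
rewrite /h big_mkcond /=; apply: ltr_sum => [|i _].
  by apply/hasP; exists ord0 => //; rewrite mem_index_enum.
have ed : 0 < eps / d.+1%:R by rewrite divr_gt0.
case: ifP => [ni|//].
rewrite gt_max ed gE /= -mulNr ltr_pdivrMr // ltrNl -mulNr.
by rewrite ltNge; apply/negP => hi; apply: H; exists i.
Qed.

(** * The penalty bound *)

(** The coordinate of [e i] is affine; at a common vertex it is 1 or 0. *)
Lemma shared_vertex_decomposition (R : realType) d
    (e e' : 'I_d.+1 -> 'cV[R]_d) i x :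
  aff_indep e -> aff_indep e' ->
  bary e i x = \sum_(l | e' l == e i) bary e' l x +
    \sum_(l | ~~ listed e (e' l)) bary e' l x * bary e i (e' l).
Proof.
move=> eI e'I.
rewrite -{1}(bary_comb x e'I) (affine_comb _ (bary_affine e i)) ?bary_sum //.
rewrite [X in X + _]big_mkcond [X in _ + X]big_mkcond -big_split /=.
apply: eq_bigr => l _.
have [/existsP[k /eqP <-]|nl] := boolP (listed e (e' l)).
  rewrite bary_vertex // addr0 (inj_eq (aff_indep_inj eI)) eq_sym.
  by case: ifP => _; rewrite ?mulr1 ?mulr0.
rewrite ifN ?add0r //; apply: contraNneq nl => ->.
by apply/existsP; exists i.
Qed.

(** The sum [H] is the value at [x] of the function that is affine on the
    simplex of [e'], 1 at [e i0] and 0 at the other vertices. The coordinate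
    of [e i0] exceeds it only through the weight that [x] gives to the
    vertices of [e'] outside [e], and that weight forces some other
    coordinate to be negative in proportion. *)
Lemma hat_penalty_bound (R : realType) d (e e' : 'I_d.+1 -> 'cV[R]_d) :
  aff_indep e -> aff_indep e' -> meet_along_shared_face e e' ->
  exists K : R, forall i0 x, closure (Defs.conv e') x -> 0 <= bary e i0 x ->
    let H := \sum_(l | e' l == e i0) bary e' l x in
    bary e i0 x <= H \/
    exists2 i, i != i0 & forall kappa, K <= kappa ->
      bary e i0 x + kappa * bary e i x <= H.
Proof.
move=> eI e'I meet.
have [eps eps0 epsP] := opposite_face_uniformly_separated eI e'I meet.
pose Lam := \sum_i \sum_l `|bary e i (e' l)|.
have LamP i l : bary e i (e' l) <= Lam.
  apply: le_trans (ler_norm _) _.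
  rewrite /Lam (bigD1 i) //= (bigD1 l) //= -addrA lerDl.
  by rewrite addr_ge0 ?sumr_ge0 // => k _; rewrite ?sumr_ge0.
exists (Lam / eps) => i0 x /(closure_conv_bary _ e'I) mu0 lam0 H.
(* The weights of x at the vertices outside the first simplex. *)
pose nu l := if listed e (e' l) then 0 else bary e' l x.
have nu0 l : 0 <= nu l by rewrite /nu; case: ifP.
have lamE i : bary e i x = \sum_(l | e' l == e i) bary e' l x +
    \sum_l nu l * bary e i (e' l).
  rewrite (shared_vertex_decomposition i x eI e'I); congr (_ + _).
  rewrite big_mkcond; apply: eq_bigr => l _; rewrite /nu.
  by case: (listed e (e' l)); rewrite ?mul0r.
have excess : \sum_l nu l * bary e i0 (e' l) <= Lam * \sum_l nu l.
  by rewrite mulr_sumr; apply: ler_sum => l _; rewrite mulrC ler_wpM2r.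
have : 0 <= \sum_l nu l by exact: sumr_ge0.
rewrite le_eqVlt => /predU1P[W0|W0].
  by left; rewrite lamE -/H -W0 mulr0 in excess *; rewrite gerDl.
right; have [|i ni sep] := epsP nu nu0 _ W0.
  by move=> l; rewrite /nu => ->.
have lami : bary e i x = \sum_l nu l * bary e i (e' l).
  rewrite lamE big1 ?add0r // => l /eqP El; case/negP: ni.
  by apply/existsP; exists l; rewrite El.
rewrite -lami in sep.
exists i => [|kappa].
  apply: contraTneq lam0 => <-; rewrite -ltNge; apply: le_lt_trans sep _.
  by rewrite mulNr oppr_lt0 mulr_gt0.
rewrite ler_pdivrMr // => hk; rewrite lamE -/H -addrA gerDl.
have kappa0 : 0 <= kappa.
  rewrite -(pmulr_lge0 _ eps0); apply: le_trans hk.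
  by apply: sumr_ge0 => k _; exact: sumr_ge0.
have := ler_wpM2l kappa0 sep.
have := ler_wpM2r (ltW W0) hk.
move: excess; set W := \sum_l nu l; set E := \sum_l _; move: (bary e i x).
by move=> ? ? ? ?; lra.
Qed.

Lemma finite_uniform_bound (R : realType) (T : choiceType) (A : set T)
    (P : T -> R -> Prop) :
  finite_set A -> (forall x K K', K <= K' -> P x K -> P x K') ->
  (forall x, A x -> exists K, P x K) ->
  exists2 K, 0 < K & forall x, A x -> P x K.
Proof.
move=> /finite_seqP[s ->] mono; elim: s => [|x s IH] H; first by exists 1.
have [|K K0 KP] := IH; first by move=> y ys; apply: H; rewrite /= inE ys orbT.
have [|K' KP'] := H x; first by rewrite /= inE eqxx.
exists (Num.max K K') => [|y]; first by rewrite lt_max K0.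
rewrite /= inE => /predU1P[->|ys].
  by apply: mono KP'; rewrite le_max lexx orbT.
by apply: mono (KP y ys); rewrite le_max lexx.
Qed.

Lemma hat_closure (R : realType) d (Omega : set 'cV[R]_d) TT p theta T e x :
  regular_simplicial_partition Omega TT -> is_hat Omega TT p theta ->
  TT T -> is_simplex e T -> closure T x ->
  theta x = \sum_(l | e l == p) bary e l x.
Proof.
move=> [_ _ _ cover _] [ct aff tp tv] TTT [eI TE] clx.
have [A [b thE]] := aff T TTT.
pose g (y : 'cV[R]_d) := (A *m y) 0 0 + b.
have ga : affine_on setT g by exists A, b.
have clT : closure T `<=` closure Omega.
  by rewrite cover => y Ty; exists T.
have thg : {in closure T `&` closure Omega, theta =1 g}.
  apply: within_continuous_eq_closure => //; first exact: affine_continuous.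
    exact: subset_trans (@subset_closure _ T) clT.
  by move=> y /set_mem /thE.
have thgT y : closure T y -> theta y = g y.
  by move=> Ty; apply: thg; apply/mem_set; split => //; exact: clT.
rewrite thgT // -{1}(bary_comb x eI) (affine_comb _ ga) ?bary_sum //.
rewrite [RHS]big_mkcond; apply: eq_bigr => l _.
rewrite -thgT; last by rewrite TE; exact: closure_conv_vertex.
case: eqP => [->|lp]; first by rewrite tp mulr1.
rewrite tv ?mulr0 //; exists T => //.
by exists e, l.
Qed.

(** The constant does not depend on the enumeration [e], as it is obtained
    for one enumeration of each simplex of the mesh and carried over by
    [bary_reindex]. *)
Lemma mesh_hat_penalty_bound (R : realType) d (Omega : set 'cV[R]_d) TT :
  regular_simplicial_partition Omega TT ->
  exists2 K : R, 0 < K & forall T T' e p theta x kappa,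
    TT T -> TT T' -> is_simplex e T -> e ord0 = p -> is_hat Omega TT p theta ->
    closure T' x -> 0 <= bary e ord0 x -> K <= kappa ->
    bary e ord0 x <= theta x \/
    exists i, bary e ord0 x + kappa * bary e (lift ord0 i) x <= theta x.
Proof.
move=> reg; have [fin simp _ _ _] := reg.
pose P (TT' : set 'cV[R]_d * set 'cV[R]_d) (K : R) :=
  forall e p theta x kappa,
    is_simplex e TT'.1 -> e ord0 = p -> is_hat Omega TT p theta ->
    closure TT'.2 x -> 0 <= bary e ord0 x -> K <= kappa ->
    bary e ord0 x <= theta x \/
    exists i, bary e ord0 x + kappa * bary e (lift ord0 i) x <= theta x.
have [|||K K0 KP] := @finite_uniform_bound R _ (TT `*` TT) P.
- exact: finite_setX.
- move=> TT' K K' KK' PK e p theta x kappa h1 h2 h3 h4 h5 h6.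
  exact: (PK e p) (le_trans KK' h6).
- move=> [T T'] [/= TTT TTT'].
  have [f fT] := simp _ TTT; have [f' fT'] := simp _ TTT'.
  have [fI TE] := fT; have [f'I TE'] := fT'.
  have meet := mesh_meet_along_shared_face reg TTT TTT' fT fT'.
  have [K KP] := hat_penalty_bound fI f'I meet.
  exists K => e p theta x kappa /= eT ep hat clx lam0 hk.
  have [eI eE] := eT.
  have Eef : Defs.conv e = Defs.conv f by rewrite -eE.
  have [j Ej] := conv_vertices ord0 eI fI Eef.
  rewrite (hat_closure reg hat TTT' fT' clx).
  rewrite (bary_reindex x eI fI Eef Ej) in lam0 *.
  rewrite TE' in clx; have := KP j x clx lam0; rewrite -Ej ep.
  case=> [|[i ij /(_ _ hk) le]]; [by left|right].
  have [k Ek] := conv_vertices i fI eI (esym Eef).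
  case: (unliftP ord0 k) Ek => [k' ->|->] Ek.
    by exists k'; rewrite (bary_reindex x eI fI Eef (esym Ek)).
  by case/eqP: ij; apply: (aff_indep_inj fI); rewrite Ek.
by exists K => // T T' e p theta x kappa TTT TTT'; apply: (KP (T, T')).
Qed.

(** * The auxiliary hat functions and their networks *)

(** An affine function is known from its values at the vertices of [a]. For
    the row of [lift ord0 i] the value at [a (lift ord0 i)] is not given,
    and is found from the value 0 at the auxiliary point, whose coordinates
    are [1 + d * delta] at [a ord0] and [- delta] at the other vertices. *)
Lemma aux_hat_rows (R : realType) d (a : 'I_d.+1 -> 'cV[R]_d) (delta : R)
    (theta : 'cV[R]_d -> R) (A : 'M[R]_(d.+1, d)) (b : 'cV[R]_d.+1) x :
  aff_indep a -> 0 < delta -> is_aux_hat a delta theta ->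
  (forall i y, aux_simplex a delta i y -> theta y = (A *m y + b) i 0) ->
  (A *m x + b) ord0 0 = bary a ord0 x /\
  forall i, (A *m x + b) (lift ord0 i) 0 =
    bary a ord0 x + (d%:R + delta^-1) * bary a (lift ord0 i) x.
Proof.
have neq0l (k : 'I_d) : (lift ord0 k == ord0) = false by [].
move=> aI delta0 [ct [t0 tq ta] _ _] thE.
pose r (i : 'I_d.+1) (y : 'cV[R]_d) := (A *m y + b) i 0.
have ra i : affine_on setT (r i).
  by exists (row i A), (b i 0) => y _; rewrite /r -row_mul !mxE.
have thr i y : closure (aux_simplex a delta i) y -> theta y = r i y.
  move=> cly.
  suff : {in closure (aux_simplex a delta i) `&` setT, theta =1 r i}.
    by apply; rewrite inE.
  apply: within_continuous_eq_closure => //.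
  - exact: continuous_subspaceT.
  - exact: affine_continuous.
  - by move=> z /set_mem /thE.
rewrite -/(r ord0 x) -[forall i, _]/(forall i, r (lift ord0 i) x = _).
clearbody r.
have rE i y : r i y = \sum_k bary a k y * r i (a k).
  by rewrite -{1}(bary_comb y aI) (affine_comb _ (ra i)) // bary_sum.
have r00 : r ord0 (a ord0) = 1.
  by rewrite -thr //= /aux_simplex eqxx; exact: closure_conv_vertex.
have r0i i : r ord0 (a (lift ord0 i)) = 0.
  by rewrite -thr ?ta //= /aux_simplex eqxx; exact: closure_conv_vertex.
split.
  rewrite rE big_ord_recl r00 mulr1 big1 ?addr0 // => i _.
  by rewrite r0i mulr0.
move=> i.
pose c (k : 'I_d.+1) := if k == lift ord0 i then aux_point a delta else a k.
have auxE : aux_simplex a delta (lift ord0 i) = Defs.conv c.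
  by rewrite /aux_simplex neq0l.
have rc k : r (lift ord0 i) (c k) = theta (c k).
  by rewrite (thr (lift ord0 i)) // auxE; exact: closure_conv_vertex.
have rq : r (lift ord0 i) (aux_point a delta) = 0.
  by have := rc (lift ord0 i); rewrite /c eqxx tq.
have r1 : r (lift ord0 i) (a ord0) = 1.
  by have := rc ord0; rewrite /c (negbTE (neq_lift _ _)) t0.
have r0 k : k != i -> r (lift ord0 i) (a (lift ord0 k)) = 0.
  move=> ki; have := rc (lift ord0 k).
  by rewrite /c (inj_eq lift_inj) (negbTE ki) ta.
pose w (k : 'I_d.+1) : R := if k == ord0 then 1 + d%:R * delta else - delta.
have w1 : \sum_k w k = 1.
  rewrite big_ord_recl /w eqxx (eq_bigr (fun=> - delta)) => [|k _ //].
  by rewrite sumr_const card_ord -[_ *+ _]mulr_natr; ring.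
have qE : aux_point a delta = \sum_k w k *: a k.
  rewrite /aux_point big_ord_recl /w eqxx sumrB sumr_const card_ord.
  rewrite scalerBr scalerDl scale1r -addrA; congr (_ + (_ + _)).
    by rewrite -scaler_nat scalerA mulrC.
  rewrite scaler_sumr -sumrN; apply: eq_bigr => k _.
  by rewrite neq0l scaleNr.
have ri : r (lift ord0 i) (a (lift ord0 i)) = d%:R + delta^-1.
  move: rq; rewrite qE (affine_comb _ (ra _)) // big_ord_recl (bigD1 i) //=.
  rewrite big1 ?addr0 => [|k ki]; last by rewrite r0 ?mulr0.
  rewrite r1 mulr1 /w eqxx neq0l => E.
  apply: (mulfI (lt0r_neq0 delta0)); rewrite mulrDr mulfV ?gt_eqF //; lra.
rewrite rE big_ord_recl (bigD1 i) //= r1 ri big1 ?addr0 => [|k ki].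
  by rewrite mulr1 [in RHS]mulrC.
by rewrite r0 ?mulr0.
Qed.

(** Outside its simplex a subnetwork stays below the value [t] of the hat
    function: if the coordinate of [p] is negative, already the row of
    [ord0] is; otherwise the penalty bound exhibits a row that is at most
    [t]. *)
Lemma aux_net_le_hat (R : realType) d (K : R) (a : 'I_d.+1 -> 'cV[R]_d)
    (delta : R) (y : 'cV[R]_d.+1) (t : R) x :
  0 < K -> 0 < delta <= K^-1 ->
  y ord0 0 = bary a ord0 x ->
  (forall i, y (lift ord0 i) 0 =
    bary a ord0 x + (d%:R + delta^-1) * bary a (lift ord0 i) x) ->
  0 <= t ->
  (forall kappa, 0 <= bary a ord0 x -> K <= kappa ->
    bary a ord0 x <= t \/
    exists i, bary a ord0 x + kappa * bary a (lift ord0 i) x <= t) ->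
  relu (\big[Num.min/y 0 0]_i y i 0) <= t.
Proof.
move=> K0 /andP[delta0 deltaK] y0 yi t0 H.
rewrite /relu ge_max t0 /=.
have [neg|pos] := ltP (bary a ord0 x) 0.
  by apply: le_trans (bigmin_le _ ord0 _) _; rewrite y0 (le_trans (ltW neg)).
have kK : K <= d%:R + delta^-1.
  rewrite -[K]add0r lerD // -[K]invrK lef_pV2 ?posrE ?invr_gt0 //.
have [le0|[i lei]] := H _ pos kK.
  by apply: le_trans (bigmin_le _ ord0 _) _; rewrite y0.
by apply: le_trans (bigmin_le _ (lift ord0 i) _) _; rewrite yi.
Qed.

Lemma aux_net_eq_hat (R : realType) d (a : 'I_d.+1 -> 'cV[R]_d)
    (kappa : R) (y : 'cV[R]_d.+1) x :
  0 <= kappa ->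
  y ord0 0 = bary a ord0 x ->
  (forall i, y (lift ord0 i) 0 =
    bary a ord0 x + kappa * bary a (lift ord0 i) x) ->
  (forall i, 0 <= bary a i x) ->
  relu (\big[Num.min/y 0 0]_i y i 0) = bary a ord0 x.
Proof.
move=> k0 y0 yi pos.
have -> : \big[Num.min/y 0 0]_i y i 0 = bary a ord0 x.
  apply/le_anti/andP; split.
    by apply: le_trans (bigmin_le _ ord0 _) _; rewrite y0.
  apply: le_bigmin => [|i _]; first by rewrite -y0.
  case: (unliftP ord0 i) => [k ->|->]; last by rewrite y0.
  by rewrite yi lerDl mulr_ge0.
by rewrite /relu max_r.
Qed.

(** * Depth and size *)

(** The left-hand side is the depth in the form in which the type of the
    concatenation delivers it: no hidden layer in the affine map, [Lmn.+1]
    more after the minimum network, 2 after the ReLU network and [Lmx.+1]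
    after the maximum network. *)
Lemma depth_bound (R : realType) (s d Lmx Lmn : nat) :
  (Lmx.+1)%:R <= 2 + log2 (s.+1%:R : R) ->
  (Lmn.+1)%:R <= 2 + log2 (d.+1%:R : R) ->
  ((0 + Lmn.+1 + 2 + Lmx.+1).+1)%:R <= 7 + log2 (s.+1%:R : R) + log2 d.+1%:R.
Proof.
move: (log2 _) (log2 _) => u v hs hd.
have -> : ((0 + Lmn.+1 + 2 + Lmx.+1).+1)%:R = Lmn.+1%:R + Lmx.+1%:R + 3 :> R.
  by rewrite -!natrD; congr (_%:R); lia.
by lra.
Qed.

(** The constant uses [d + 1 <= d ^ 2] and [(d + 1) ^ 2 <= 4 d ^ 2], both
    valid for [2 <= d]. *)
Lemma size_bound (R : realType) (C0 : R) (s d mmax : nat)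
    (maux : 'I_s.+1 -> nat) (mmin : nat) :
  (2 <= d)%N -> 0 <= C0 ->
  mmax%:R <= C0 * s.+1%:R -> mmin%:R <= C0 * d.+1%:R ->
  (forall j, maux j <= 4 + 4 * mmin + 4 * (d.+1 * d.+1))%N ->
  (2 * mmax + 2 * \sum_j maux j)%:R <=
    (10 * C0 + 40) * d%:R ^+ 2 * s.+1%:R :> R.
Proof.
move=> d2 C00 hmax hmin haux.
have hsum : (\sum_j maux j <= s.+1 * (4 + 4 * mmin + 4 * (d.+1 * d.+1)))%N.
  have := leq_sum (P := predT) (index_enum _) (fun j _ => haux j).
  by rewrite sum_nat_const card_ord.
have dR : 2 <= d%:R :> R by rewrite (ler_nat R 2).
have sR : 0 < s.+1%:R :> R by rewrite ltr0n.
have dS : d.+1%:R = d%:R + 1 :> R by rewrite -natr1.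
have hsumR : (\sum_j maux j)%:R <=
    s.+1%:R * (4 + 4 * mmin%:R + 4 * (d.+1%:R * d.+1%:R)) :> R.
  by rewrite -!natrM -!natrD -natrM ler_nat.
rewrite natrD !natrM; rewrite dS in hmin hsumR.
move: (d%:R) (s.+1%:R) (mmin%:R) (mmax%:R) ((\sum_j maux j)%:R)
  dR sR hmax hmin hsumR
  => D n mn mx S dR sR {}hmax {}hmin {}hsumR.
have dd : D + 1 <= D ^+ 2 by rewrite expr2; nra.
have dd2 : (D + 1) * (D + 1) <= 4 * D ^+ 2 by rewrite expr2; nra.
have d1 : 1 <= D ^+ 2 by lra.
have hm : mn <= C0 * D ^+ 2.
  by apply: le_trans hmin _; rewrite ler_wpM2l.
have hin : 4 + 4 * mn + 4 * ((D + 1) * (D + 1)) <= (20 + 4 * C0) * D ^+ 2.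
  lra.
have hS : S <= n * ((20 + 4 * C0) * D ^+ 2).
  by apply: le_trans hsumR _; rewrite ler_wpM2l // ltW.
have hM : mx <= C0 * D ^+ 2 * n.
  apply: le_trans hmax _; rewrite ler_wpM2r ?(ltW sR) //.
  by rewrite ler_peMr.
have -> : (10 * C0 + 40) * D ^+ 2 * n =
  2 * (C0 * D ^+ 2 * n) + 2 * (n * ((20 + 4 * C0) * D ^+ 2)).
  by ring.
lra.
Qed.

(** * The hat function of a vertex *)

Theorem theorem4p3 (R : realType) (C0 : R) (Lmax Lmin : nat -> nat)
    (Phimax : forall n, nn R n 1 (Lmax n))
    (Phimin : forall n, nn R n 1 (Lmin n))
    (hmax : nn_max_family C0 Phimax) (hmin : nn_min_family C0 Phimin) :
  exists C : R, 0 < C /\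
  forall (d : nat) (Omega : set 'cV[R]_d) (TT : set (set 'cV[R]_d))
    (p : 'cV[R]_d),
  (2 <= d)%N ->
  bounded_polytopal_domain Omega ->
  regular_simplicial_partition Omega TT ->
  mesh_vertex TT p ->
  exists delta_bar : R, 0 < delta_bar /\
  forall (s : nat) (T : 'I_s.+1 -> set 'cV[R]_d)
    (a : 'I_s.+1 -> 'I_d.+1 -> 'cV[R]_d)
    (delta : 'I_s.+1 -> R)
    (theta_aux : 'I_s.+1 -> 'cV[R]_d -> R)
    (A : 'I_s.+1 -> 'M[R]_(d.+1, d)) (b : 'I_s.+1 -> 'cV[R]_d.+1)
    (theta : 'cV[R]_d -> R),
  injective T -> range T = adjacent_simplices TT p ->
  (forall j, is_simplex (a j) (T j) /\ a j ord0 = p) ->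
  (forall j, 0 < delta j <= delta_bar) ->
  (forall j, is_aux_hat (a j) (delta j) (theta_aux j)) ->
  (forall j i x, aux_simplex (a j) (delta j) i x ->
     theta_aux j x = (A j *m x + b j) i 0) ->
  is_hat Omega TT p theta ->
  let Phi := nn_concat (Phimax s.+1)
               (nn_pars (fun j => nn_aux_hat Phimin (A j) (b j))) in
  [/\ forall x, Omega x -> realize Phi x 0 0 = theta x,
      (depth Phi)%:R <= 7 + log2 (s.+1%:R : R) + log2 d.+1%:R &
      (nn_size Phi)%:R <= C * d%:R ^+ 2 * s.+1%:R].
Proof.
(* The bound for one input forces C0 to be nonnegative. *)
have C00 : 0 <= C0.
  have [_ _ _] := hmax 0; rewrite mulr1; exact: le_trans (ler0n _ _).
exists (10 * C0 + 40); split; first by lra.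
move=> d Omega TT p d2 _ reg _.
have [K K0 KP] := mesh_hat_penalty_bound reg.
exists K^-1; split; first by rewrite invr_gt0.
move=> s T a delta theta_aux A b theta _ Trange aT deltaP auxP affP hat Phi.
have [_ maxR depthmax sizemax] := hmax s.
have [_ minR depthmin sizemin] := hmin d.
split; first last.
- apply: (@le_trans _ _ _ _ _ _ (size_bound d2 C00 sizemax sizemin
    (fun j => nn_size_aux_hat Phimin (A j) (b j)))).
  by rewrite ler_nat -nn_size_pars; exact: nn_size_concat.
- exact: depth_bound depthmax depthmin.
move=> x Ox; rewrite /Phi realize_concat maxR.
have TTj j : TT (T j) /\ closure (T j) p.
  suff : range T (T j) by rewrite Trange.
  by exists j.
pose y j := A j *m x + b j.
have netE j : realize (nn_pars (fun j => nn_aux_hat Phimin (A j) (b j))) x j 0 =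
    relu (\big[Num.min/y j 0 0]_i y j i 0).
  by rewrite realize_pars realize_aux_hat minR.
have rows j := aux_hat_rows x (aT j).1.1 (andP (deltaP j)).1 (auxP j) (affP j).
have [T' TTT' T'x] : exists2 T', TT T' & closure T' x.
  have [_ _ _ cover _] := reg.
  have : closure Omega x by exact: subset_closure.
  by rewrite cover => -[T' ? ?]; exists T'.
have [_ simp _ _ _] := reg.
have [e eT'] := simp _ TTT'.
have [eI T'E] := eT'.
have thE := hat_closure reg hat TTT' eT' T'x.
have e0 l : 0 <= bary e l x by apply: (closure_conv_bary _ eI).1; rewrite -T'E.
have th0 : 0 <= theta x by rewrite thE sumr_ge0.
have netle j : relu (\big[Num.min/y j 0 0]_i y j i 0) <= theta x.
  apply: (aux_net_le_hat K0 (deltaP j) (rows j).1 (rows j).2 th0).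
  move=> kappa lam0 hk.
  exact: (KP _ _ _ _ _ _ _ (TTj j).1 TTT' (aT j).1 (aT j).2 hat T'x lam0 hk).
apply/le_anti/andP; split.
  by apply: bigmax_le => [|j _]; rewrite netE.
have [T'p|nT'p] := pselect (closure T' p); last first.
  rewrite thE big_pred0 => [|l].
    apply: le_trans (le_bigmax _ _ ord0); rewrite netE.
    by rewrite /relu le_max lexx.
  apply/negbTE/eqP => ep; apply: nT'p; rewrite -ep T'E.
  exact: closure_conv_vertex.
have [j _ Tj] : range T T' by rewrite Trange.
apply: le_trans (le_bigmax _ _ j); rewrite netE.
have [[aI TE] ap] := aT j.
have aux0 : 0 <= d%:R + (delta j)^-1.
  by rewrite addr_ge0 // invr_ge0 ltW //; case/andP: (deltaP j).
rewrite (aux_net_eq_hat aux0 (rows j).1 (rows j).2); last first.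
  by apply/(closure_conv_bary _ aI); rewrite -TE Tj.
rewrite (hat_closure reg hat TTT' (e := a j)) //; last by rewrite -Tj.
rewrite (big_pred1 ord0) // => l.
by rewrite -ap (inj_eq (aff_indep_inj aI)).
Qed.
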